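(* Let $\mathbb{K}$ be any field, let $L$ be an integer lattice (a free abelian group of finite rank), and let $I\subset\mathbb{K}[L]$ be an ideal of the group ring. Then $I\cap\mathbb{K}[T(I)^\perp\cap L]$ is an Artinian ideal in $\mathbb{K}[T(I)^\perp\cap L]$; that is, the quotient ring $\mathbb{K}[T(I)^\perp\cap L]\,/\,\bigl(I\cap\mathbb{K}[T(I)^\perp\cap L]\bigr)$ is Artinian.
   Context: The group ring $\mathbb{K}[L]$ has $\mathbb{K}$-basis the Laurent monomials $\mathbf{x}^v$, $v\in L$ (for $L=\mathbb{Z}^n$ it is the Laurent polynomial ring $\mathbb{K}[x_1^{\pm},\dots,x_n^{\pm}]$). Let $M=\mathrm{Hom}(L,\mathbb{Z})$ be the dual lattice. For $\omega\in\mathbb{Q}\otimes M$ and $f=\sum_v c_v\mathbf{x}^v\in\mathbb{K}[L]$, the initial form $\mathrm{in}_\omega(f)$ is the sum of those terms $c_v\mathbf{x}^v$ of $f$ (with $c_v\neq 0$) for which $\langle\omega,v\rangle$ is maximal. For an ideal $I\subset\mathbb{K}[L]$, the initial ideal is $\mathrm{in}_\omega(I)=\langle\mathrm{in}_\omega(f): f\in I\rangle$, and the tropical variety of $I$ is $T(I)=\{\omega\in\mathbb{Q}\otimes M : \mathrm{in}_\omega(I)\neq\mathbb{K}[L]\}$. Its orthogonal complement is $T(I)^\perp=\{v\in\mathbb{Q}\otimes L : \langle\omega,v\rangle=0\text{ for all }\omega\in T(I)\}$, and $T(I)^\perp\cap L$ is the resulting sublattice of $L$, with group ring $\mathbb{K}[T(I)^\perp\cap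 L]\subseteq\mathbb{K}[L]$. An ideal is called Artinian if the quotient of its ambient ring by it is an Artinian ring (the zero ring is allowed). *)

(* Defs.v *)
From HB Require Import structures.
From mathcomp Require Import all_boot all_order all_algebra generic_quotient.
From mathcomp Require Import finmap.
From mathcomp.multinomials Require Import monalg.
From mathcomp Require Import boolp.

Set Implicit Arguments.
Unset Strict Implicit.
Unset Printing Implicit Defensive.

Import Order.TTheory GRing.Theory Num.Theory.

Local Open Scope fset_scope.
Local Open Scope ring_scope.

(* Ideals are [Prop]-valued and may be improper, hence quotients may be zero:
   neither is the case of [idealr] and [{ideal_quot _}] in [ring_quotient]. *)
Record ideal (R : comPzRingType) := Ideal {
  ideal_mem :> R -> Prop;
  ideal0 : ideal_mem 0;
  idealD : forall x y, ideal_mem x -> ideal_mem y -> ideal_mem (x + y);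
  idealM : forall a x, ideal_mem x -> ideal_mem (a * x) }.

Section IdealTheory.
Variables (R : comPzRingType) (J : ideal R).

Lemma idealN x : J x -> J (- x).
Proof. by rewrite -mulN1r; exact: idealM. Qed.

Lemma idealB x y : J x -> J y -> J (x - y).
Proof. by move=> Jx /idealN; exact: idealD. Qed.

End IdealTheory.

Section GeneratedIdeal.
Variables (R : comPzRingType) (S : R -> Prop).

Definition gen_set (x : R) : Prop :=
  forall J : ideal R, (forall y, S y -> J y) -> J x.

Lemma gen_set0 : gen_set 0.
Proof. by move=> J _; exact: ideal0. Qed.

Lemma gen_setD x y : gen_set x -> gen_set y -> gen_set (x + y).
Proof. by move=> gx gy J SJ; apply: idealD; [exact: gx | exact: gy]. Qed.

Lemma gen_setM a x : gen_set x -> gen_set (a * x).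
Proof. by move=> gx J SJ; apply: idealM; exact: gx. Qed.

Definition gen_ideal : ideal R := Ideal gen_set0 gen_setD gen_setM.

End GeneratedIdeal.

Section Contraction.
Variables (A B : comPzRingType) (f : {rmorphism A -> B}) (J : ideal B).

Let preim (x : A) : Prop := J (f x).

Let preim0 : preim 0.
Proof. by rewrite /preim rmorph0; exact: ideal0. Qed.

Let preimD x y : preim x -> preim y -> preim (x + y).
Proof. by rewrite /preim rmorphD; exact: idealD. Qed.

Let preimM a x : preim x -> preim (a * x).
Proof. by rewrite /preim rmorphM; exact: idealM. Qed.

Definition contraction : ideal A := Ideal preim0 preimD preimM.

End Contraction.

Section IdealQuotient.
Local Open Scope quotient_scope.
Variables (R : comPzRingType) (J : ideal R).

Definition ideal_rel : rel R := fun x y => `[< J (x - y) >].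

Let ideal_rel_refl : reflexive ideal_rel.
Proof. by move=> x; apply/asboolP; rewrite subrr; exact: ideal0. Qed.

Let ideal_rel_sym : symmetric ideal_rel.
Proof.
by move=> x y; apply: asbool_equiv_eq; split=> /idealN; rewrite opprB.
Qed.

Let ideal_rel_trans : transitive ideal_rel.
Proof.
move=> y x z /asboolP xy /asboolP yz; apply/asboolP.
by rewrite -(subrKA y) ; exact: idealD.
Qed.

Canonical ideal_equiv : equiv_rel R :=
  EquivRel ideal_rel ideal_rel_refl ideal_rel_sym ideal_rel_trans.

Definition quot_ring := {eq_quot ideal_equiv}.

HB.instance Definition _ := Choice.on quot_ring.
HB.instance Definition _ : EqQuotient _ ideal_equiv quot_ring :=
  EqQuotient.on quot_ring.

Lemma quot_ringP x y : (\pi_quot_ring x == \pi_quot_ring y) = ideal_rel x y.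
Proof. by rewrite piE. Qed.

Definition quot_zero : quot_ring := lift_cst quot_ring 0.
Definition quot_opp := lift_op1 quot_ring -%R.
Definition quot_add := lift_op2 quot_ring +%R.
Definition quot_one : quot_ring := lift_cst quot_ring 1.
Definition quot_mul := lift_op2 quot_ring *%R.

Canonical quot_zero_morph := PiConst quot_zero.
Canonical quot_one_morph := PiConst quot_one.

Let repr_rel x : J (x - repr (\pi_quot_ring x)).
Proof. by apply/asboolP; rewrite -[asbool _]quot_ringP reprK. Qed.

Lemma quot_piN : {morph \pi_quot_ring : x / - x >-> quot_opp x}.
Proof.
move=> x; unlock quot_opp; apply/eqP; rewrite quot_ringP; apply/asboolP.
by rewrite -opprD; exact: idealN.
Qed.
Canonical quot_opp_morph := PiMorph1 quot_piN.

Lemma quot_piD : {morph \pi_quot_ring : x y / x + y >-> quot_add x y}.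
Proof.
move=> x y; unlock quot_add; apply/eqP; rewrite quot_ringP; apply/asboolP.
by rewrite opprD addrACA; apply: idealD.
Qed.
Canonical quot_add_morph := PiMorph2 quot_piD.

Lemma quot_piM : {morph \pi_quot_ring : x y / x * y >-> quot_mul x y}.
Proof.
move=> x y; unlock quot_mul; apply/eqP; rewrite quot_ringP; apply/asboolP.
rewrite -(subrKA (x * repr (\pi_quot_ring y))) -mulrBr -mulrBl.
by apply: idealD; [exact: idealM | rewrite mulrC; exact: idealM].
Qed.
Canonical quot_mul_morph := PiMorph2 quot_piM.

Let addqA : associative quot_add.
Proof. by move=> x y z; rewrite -[x]reprK -[y]reprK -[z]reprK !piE addrA. Qed.

Let addqC : commutative quot_add.
Proof. by move=> x y; rewrite -[x]reprK -[y]reprK !piE addrC. Qed.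

Let add0q : left_id quot_zero quot_add.
Proof. by move=> x; rewrite -[x]reprK !piE add0r. Qed.

Let addNq : left_inverse quot_zero quot_opp quot_add.
Proof. by move=> x; rewrite -[x]reprK !piE addNr. Qed.

HB.instance Definition _ :=
  GRing.isZmodule.Build quot_ring addqA addqC add0q addNq.

Let mulqA : associative quot_mul.
Proof. by move=> x y z; rewrite -[x]reprK -[y]reprK -[z]reprK !piE mulrA. Qed.

Let mulqC : commutative quot_mul.
Proof. by move=> x y; rewrite -[x]reprK -[y]reprK !piE mulrC. Qed.

Let mul1q : left_id quot_one quot_mul.
Proof. by move=> x; rewrite -[x]reprK !piE mul1r. Qed.

Let mulqDl : left_distributive quot_mul (@GRing.add quot_ring).
Proof.
by move=> x y z; rewrite -[x]reprK -[y]reprK -[z]reprK /GRing.add /= !piE mulrDl.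
Qed.

HB.instance Definition _ :=
  GRing.Zmodule_isComPzRing.Build quot_ring mulqA mulqC mul1q mulqDl.

Lemma quot_pi_is_zmod_morphism : zmod_morphism \pi_quot_ring.
Proof. by move=> x y; rewrite quot_piD quot_piN. Qed.

Lemma quot_pi_is_monoid_morphism : monoid_morphism \pi_quot_ring.
Proof. by split=> [|x y]; [rewrite -[RHS]/quot_one piE | exact: quot_piM]. Qed.

End IdealQuotient.

Definition artinian (A : comPzRingType) : Prop :=
  forall J : nat -> ideal A, (forall n x, J n.+1 x -> J n x) ->
  exists n, forall m, (n <= m)%N -> forall x, J m x <-> J n x.

Definition artinian_ideal (R : comPzRingType) (J : ideal R) : Prop :=
  artinian (quot_ring J).

Definition is_lattice (L : zmodType) : Prop :=
  exists (n : nat) (b : 'I_n -> L),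
    forall v : L, exists! c : {ffun 'I_n -> int}, v = \sum_i b i *~ c i.

(* [monalg] makes [{malg R[G]}] a ring only when [G] is a monoid without
   non-trivial units. *)
Definition group_ring (R : nzRingType) (L : zmodType) := {malg R[L]}.

Section GroupRing.
Variables (R : nzRingType) (L : zmodType).
Local Notation RL := (group_ring R L).
Implicit Types f g h : RL.

HB.instance Definition _ := GRing.Lmodule.on RL.

Definition gr_one : RL := << (0 : L) >>.

Definition gr_mul f g : RL :=
  \sum_(u <- msupp f) \sum_(v <- msupp g) << f@_u * g@_v *g u + v >>.

Let mulw (d1 d2 : {fset L}) f g :
  (msupp f `<=` d1)%fset -> (msupp g `<=` d2)%fset ->
  gr_mul f g = \sum_(u <- d1) \sum_(v <- d2) << f@_u * g@_v *g u + v >>.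
Proof.
move=> le_d1 le_d2; rewrite /gr_mul (big_fset_incl _ le_d1) /=.
  apply/eq_bigr=> u _; apply/big_fset_incl => // k _ /mcoeff_outdom ->.
  by rewrite mulr0 monalgU0.
move=> k _ /mcoeff_outdom fk.
by rewrite big1 => // k' _; rewrite fk mul0r monalgU0.
Qed.

Let mulU c u g :
  gr_mul << c *g u >> g = \sum_(v <- msupp g) << c * g@_v *g u + v >>.
Proof.
rewrite (mulw msuppU_le (fsubset_refl _)) big_seq_fset1.
by apply/eq_bigr => v _; rewrite mcoeffUU.
Qed.

Let mulrU c u g :
  gr_mul g << c *g u >> = \sum_(v <- msupp g) << g@_v * c *g v + u >>.
Proof.
rewrite (mulw (fsubset_refl _) msuppU_le); apply/eq_bigr => v _.
by rewrite big_seq_fset1 mcoeffUU.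
Qed.

Lemma gr_mulUU c1 c2 (u v : L) :
  gr_mul << c1 *g u >> << c2 *g v >> = << c1 * c2 *g u + v >>.
Proof. by rewrite (mulw msuppU_le msuppU_le) !big_seq_fset1 !mcoeffUU. Qed.

Let mul1g : left_id gr_one gr_mul.
Proof.
move=> g; rewrite mulU [RHS]monalgE.
by apply/eq_bigr=> v _; rewrite mul1r add0r.
Qed.

Let mulg1 : right_id gr_one gr_mul.
Proof.
move=> g; rewrite mulrU [RHS]monalgE.
by apply/eq_bigr=> v _; rewrite mulr1 addr0.
Qed.

Let mulDl : left_distributive gr_mul +%R.
Proof.
move=> f g h.
rewrite [in RHS](mulw (fsubsetUl _ (msupp g)) (fsubset_refl _)).
rewrite [in RHS](mulw (fsubsetUr (msupp f) _) (fsubset_refl _)).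
rewrite (mulw (msuppD_le _ _) (fsubset_refl _)).
rewrite -big_split /=; apply/eq_bigr=> u _.
rewrite -big_split /=; apply/eq_bigr=> v _.
by rewrite mcoeffD mulrDl monalgUD.
Qed.

Let mulDr : right_distributive gr_mul +%R.
Proof.
move=> h f g.
rewrite [in RHS](mulw (fsubset_refl _) (fsubsetUl _ (msupp g))).
rewrite [in RHS](mulw (fsubset_refl _) (fsubsetUr (msupp f) _)).
rewrite (mulw (fsubset_refl _) (msuppD_le _ _)).
rewrite -big_split /=; apply/eq_bigr=> u _.
rewrite -big_split /=; apply/eq_bigr=> v _.
by rewrite mcoeffD mulrDr monalgUD.
Qed.

Let mul0g : left_zero 0 gr_mul.
Proof. by move=> g; rewrite /gr_mul msupp0 big_seq_fset0. Qed.

Let mulg0 : right_zero 0 gr_mul.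
Proof. by move=> g; rewrite /gr_mul big1 // => u _; rewrite msupp0 big_seq_fset0. Qed.

Let mulA : associative gr_mul.
Proof.
have El f g : gr_mul f g = \sum_(u <- msupp f) gr_mul << f@_u *g u >> g.
  by apply/eq_bigr=> k _; rewrite mulU.
have Er f g : gr_mul f g = \sum_(v <- msupp g) gr_mul f << g@_v *g v >>.
  by rewrite [LHS]exchange_big; apply/eq_bigr=> k _; rewrite mulrU.
move=> f g h.
rewrite [RHS](big_morph (gr_mul^~ _) (fun _ _ => mulDl _ _ _) (mul0g _)).
rewrite El; apply/eq_bigr=> u _.
rewrite [LHS](big_morph (gr_mul _) (fun _ _ => mulDr _ _ _) (mulg0 _)).
rewrite [RHS](big_morph (gr_mul^~ _) (fun _ _ => mulDl _ _ _) (mul0g _)).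
apply/eq_bigr=> v _.
rewrite (big_morph (gr_mul _) (fun _ _ => mulDr _ _ _) (mulg0 _)) [RHS]Er.
by apply/eq_bigr=> w _; rewrite !gr_mulUU mulrA addrA.
Qed.

Let oner_neq0 : gr_one != 0.
Proof. by apply/eqP/malgP=> /(_ 0) /eqP; rewrite !mcoeffsE oner_eq0. Qed.

HB.instance Definition _ :=
  GRing.Zmodule_isNzRing.Build RL mulA mul1g mulg1 mulDl mulDr oner_neq0.

End GroupRing.

Section ComGroupRing.
Variables (R : comNzRingType) (L : zmodType).

Let mulC : commutative (@GRing.mul (group_ring R L)).
Proof.
move=> f g; rewrite /GRing.mul /= /gr_mul exchange_big /=.
by apply/eq_bigr=> u _; apply/eq_bigr=> v _; rewrite mulrC addrC.
Qed.

HB.instance Definition _ :=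
  GRing.PzRing_hasCommutativeMul.Build (group_ring R L) mulC.

End ComGroupRing.

Section SubGroupRing.
Variables (R : comNzRingType) (L : zmodType) (S : zmodClosed L).
Local Notation RL := (group_ring R L).

Definition supported_in : {pred RL} :=
  [pred f : RL | all (fun v => v \in S) (msupp f)].

Let suppP (f : RL) :
  reflect (forall v, v \notin S -> f@_v = 0) (f \in supported_in).
Proof.
apply: (iffP allP) => [Sf v Sv | Sf v].
  by apply: mcoeff_outdom; apply: contra Sv; exact: Sf.
by rewrite -mcoeff_neq0; apply: contraR => /Sf ->.
Qed.

Let supp_subring : subring_closed supported_in.
Proof.
split=> [|f g /suppP Sf /suppP Sg|f g /allP Sf /allP Sg].
- apply/suppP=> v Sv; rewrite mcoeffU; case: eqP => // v0.
  by rewrite -v0 rpred0 in Sv.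
- by apply/suppP=> v Sv; rewrite mcoeffB Sf // Sg // subr0.
apply/suppP=> w Sw; rewrite /GRing.mul /= /gr_mul raddf_sum big_seq big1 //=.
move=> u uf; rewrite raddf_sum big_seq big1 //= => v vg.
rewrite mcoeffU; case: eqP => // uv.
by rewrite -uv rpredD ?(Sf u uf) ?(Sg v vg) in Sw.
Qed.

HB.instance Definition _ := GRing.isSubringClosed.Build RL supported_in
  supp_subring.

(* The group ring R[S] of the subgroup S, as the subring of R[L] of the elements
   whose monomials x^v all have v in S; [\val] is the inclusion. *)
Record sub_group_ring := SubGroupRing {
  sgr_val :> RL;
  sgr_valP : sgr_val \in supported_in }.

HB.instance Definition _ := [isSub for sgr_val].
HB.instance Definition _ := [Choice of sub_group_ring by <:].
HB.instance Definition _ :=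
  [SubChoice_isSubComNzRing of sub_group_ring by <:].

End SubGroupRing.

Definition restrict_ideal (R : comNzRingType) (L : zmodType) (S : zmodClosed L)
    (I : ideal (group_ring R L)) : ideal (sub_group_ring R S) :=
  contraction (\val : sub_group_ring R S -> group_ring R L) I.

(* For M = Hom(L, Z) with L free of finite rank, the canonical map from
   Q (x) M to Hom(L, Q) sending q (x) m to v |-> q * m v is an isomorphism. Hence
   a weight in Q (x) M is an additive map w from L to rat, and the pairing <w, v>
   with v in L is w v. The lemma is the surjectivity of that map. *)
Lemma additive_rat_fraction (L : zmodType) (w : {additive L -> rat}) :
  is_lattice L ->
  exists (q : rat) (m : {additive L -> int}), forall v, w v = q * (m v)%:~R.
Proof.
case=> n [b bL]; pose d := \prod_i denq (w (b i)).
have d0 : d%:~R != 0 :> rat.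
  by rewrite intr_eq0; apply/prodf_neq0=> i _; exact: denq_neq0.
have wd v : w v * d%:~R \is a Num.int.
  case: (bL v) => c [-> _]; rewrite raddf_sum mulr_suml rpred_sum //= => i _.
  rewrite raddfMz -mulrzl -mulrA; apply: rpredM; first exact: intr_int.
  rewrite /d (bigD1 i) //= intrM mulrA; apply: rpredM; last exact: intr_int.
  by rewrite -{1}(divq_num_den (w (b i))) divfK ?intr_int // intr_eq0 denq_neq0.
pose m v := numq (w v * d%:~R).
have mE v : (m v)%:~R = w v * d%:~R by exact: numqK.
have m_additive : zmod_morphism m.
  move=> u v; apply: (@intr_inj rat).
  by rewrite intrB !mE raddfB mulrBl.
pose M := GRing.isZmodMorphism.Build L int m m_additive.
pose mA : {additive L -> int} := HB.pack m M.
by exists (d%:~R)^-1, mA => v; rewrite /= mE mulrC mulfK.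
Qed.

Section Tropical.
Variables (K : fieldType) (L : zmodType).
Implicit Types (w : {additive L -> rat}) (I : ideal (group_ring K L)).

Definition initial_form w (f : group_ring K L) : group_ring K L :=
  \sum_(v <- msupp f | all (fun u => w u <= w v) (msupp f)) << f@_v *g v >>.

Definition initial_ideal w I : ideal (group_ring K L) :=
  gen_ideal (fun g => exists2 f, I f & g = initial_form w f).

Definition tropical_variety I w : Prop :=
  ~ (forall f, initial_ideal w I f).

(* T(I)^perp \cap L: the v in L whose image 1 (x) v in Q (x) L lies in T(I)^perp. *)
Definition tropical_perp I : {pred L} :=
  [pred v | `[< forall w, tropical_variety I w -> w v = 0 >]].

Let tropical_perp_zmod I : zmod_closed (tropical_perp I).
Proof.
split=> [|u v /asboolP uI /asboolP vI]; apply/asboolP=> w wI.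
  exact: raddf0.
by rewrite raddfB uI // vI // subr0.
Qed.

HB.instance Definition _ I :=
  GRing.isZmodClosed.Build L (tropical_perp I) (tropical_perp_zmod I).

End Tropical.

(* Main.v *)
Require Import Defs.
From HB Require Import structures.
From mathcomp Require Import all_boot all_order all_algebra.
From mathcomp Require Import finmap.
From mathcomp.multinomials Require Import monalg.
From mathcomp Require Import boolp classical_sets.
From mathcomp Require Import zify ring.

(* The quotient is finite dimensional over K as soon as, for every v in the
   finitely generated group T(I)^perp, the monomial x^v is algebraic over K modulo
   I.  Suppose x^v is transcendental.  Choose a maximal subgroup N of L such that
   x^v stays transcendental over K[N] modulo I.  Chevalley's argument for extending
   places, run on submonoids of L instead of subrings, gives a total translation
   invariant preorder on L that is trivial on N, makes v positive, and is compatible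
   with I: no nonzero element of K[N] is congruent modulo I to x^-v times an element
   with nonpositive exponents.  By maximality of N every x^u satisfies an algebraic
   relation over K[N + Zv]; two of its terms must have the same size, so u is
   commensurable with v up to elements infinitesimal compared to v.  The ratio is a
   rational weight w with w(v) = 1 which lies in T(I), so v is not in T(I)^perp. *)

Set Implicit Arguments.
Unset Strict Implicit.
Unset Printing Implicit Defensive.

Import Order.TTheory GRing.Theory Num.Theory.

Local Open Scope ring_scope.

(** * Supports and monomials *)

Section Support.
Variables (K : fieldType) (L : zmodType).
Local Notation KL := (group_ring K L).
Implicit Types (X Y : L -> Prop) (f g : KL) (u v : L) (c : K).

Definition mono c u : KL := << c *g u >>.

Definition supp_in X f : Prop := forall u, f@_u != 0 -> X u.

Lemma supp_in_le X Y f : (forall u, X u -> Y u) -> supp_in X f -> supp_in Y f.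
Proof. by move=> XY Xf u /Xf /XY. Qed.

Lemma supp_in0 X : supp_in X 0.
Proof. by move=> u; rewrite mcoeff0 eqxx. Qed.

Lemma supp_inD X f g : supp_in X f -> supp_in X g -> supp_in X (f + g).
Proof.
move=> Xf Xg u; rewrite mcoeffD; have [->|/Xf//] := eqVneq (f@_u) 0.
by rewrite add0r => /Xg.
Qed.

Lemma supp_inN X f : supp_in X f -> supp_in X (- f).
Proof. by move=> Xf u; rewrite mcoeffN oppr_eq0 => /Xf. Qed.

Lemma supp_inB X f g : supp_in X f -> supp_in X g -> supp_in X (f - g).
Proof. by move=> Xf /supp_inN; exact: supp_inD. Qed.

Lemma mcoeff_mono c u x : (mono c u)@_x = c *+ (u == x).
Proof. exact: mcoeffU. Qed.

Lemma mcoeff_monoUU c u : (mono c u)@_u = c.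
Proof. exact: mcoeffUU. Qed.

Lemma supp_in_mono X c u : (c != 0 -> X u) -> supp_in X (mono c u).
Proof.
move=> Xu v; rewrite mcoeff_mono; case: (u =P v) => [<-|_]; last by rewrite mulr0n eqxx.
by rewrite mulr1n.
Qed.

Lemma supp_in_sum X (T : Type) (r : seq T) (P : pred T) (F : T -> KL) :
  (forall i, P i -> supp_in X (F i)) -> supp_in X (\sum_(i <- r | P i) F i).
Proof.
by move=> XF; apply: (big_ind (supp_in X)) => //; [exact: supp_in0|exact: supp_inD].
Qed.

Lemma gr_mulE f g :
  f * g = \sum_(u <- msupp f) \sum_(v <- msupp g) mono (f@_u * g@_v) (u + v).
Proof. by []. Qed.

Lemma supp_inM X Y f g : supp_in X f -> supp_in Y g ->
  supp_in (fun w => exists u v, [/\ X u, Y v & w = u + v]) (f * g).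
Proof.
move=> Xf Yg; rewrite gr_mulE; apply: supp_in_sum => u _; apply: supp_in_sum => v _.
apply: supp_in_mono; rewrite mulf_eq0 negb_or => /andP[/Xf Xu /Yg Yv].
by exists u, v.
Qed.

Lemma mono_mul c d u v : mono c u * mono d v = mono (c * d) (u + v).
Proof. exact: gr_mulUU. Qed.

Lemma mono10 : mono 1 0 = 1.
Proof. by []. Qed.

Lemma monoV u : mono 1 u * mono 1 (- u) = 1.
Proof. by rewrite mono_mul mulr1 subrr. Qed.

Lemma mono_eq0 c u : (mono c u == 0) = (c == 0).
Proof. exact: monalgU_eq0. Qed.

Lemma group_ringE f : f = \sum_(u <- msupp f) mono f@_u u.
Proof. exact: monalgE. Qed.

Lemma mcoeff_monoM c u g x : (mono c u * g)@_x = c * g@_(x - u).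
Proof.
have [->|c0] := eqVneq c 0; first by rewrite [mono 0 u]monalgU0 !mul0r mcoeff0.
rewrite gr_mulE [msupp _]msuppU (negPf c0) big_seq_fset1 mcoeffUU raddf_sum /=.
have [xg|xg] := boolP (x - u \in msupp g); last first.
  rewrite (mcoeff_outdom xg) mulr0 big_seq big1 // => v vg.
  rewrite mcoeff_mono; case: eqP => // Ev; move: xg.
  by rewrite -Ev addrAC subrr add0r vg.
rewrite (bigD1_seq (x - u) xg (fset_uniq _)) /= mcoeff_mono (addrC u) subrK eqxx mulr1n.
rewrite big1 ?addr0 // => v vx; rewrite mcoeff_mono; case: eqP => // Ev.
by rewrite -Ev addrAC subrr add0r eqxx in vx.
Qed.

Lemma supp_in_monoM X c u g :
  supp_in X g -> supp_in (fun x => X (x - u)) (mono c u * g).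
Proof. by move=> Xg x; rewrite mcoeff_monoM mulf_eq0 negb_or => /andP[_ /Xg]. Qed.

Definition part (P : pred L) f : KL := \sum_(u <- msupp f | P u) mono f@_u u.

Lemma mcoeff_part P f x : (part P f)@_x = if P x then f@_x else 0.
Proof.
rewrite /part raddf_sum /=.
have [xf|xf] := boolP (x \in msupp f); last first.
  rewrite (mcoeff_outdom xf) if_same big_seq_cond big1 // => u /andP[uf _].
  by rewrite mcoeff_mono; case: eqP => // ux; rewrite ux (negPf xf) in uf.
rewrite -big_filter; case: ifP => Px.
  rewrite (bigD1_seq x) /= ?filter_uniq ?fset_uniq ?mem_filter ?Px //= mcoeff_monoUU.
  rewrite big1 ?addr0 // => u /negPf ux.
  by rewrite mcoeffU ux mulr0n.
rewrite big_filter big1 // => u Pu; rewrite mcoeff_mono; case: eqP => // ux.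
by rewrite ux Px in Pu.
Qed.

Lemma supp_in_part X (P : pred L) f :
  (forall u, P u -> f@_u != 0 -> X u) -> supp_in X (part P f).
Proof.
move=> PX u; rewrite mcoeff_part; case: ifP => [Pu|_]; last by rewrite eqxx.
exact: PX.
Qed.

Lemma partC P f : f = part P f + part (predC P) f.
Proof.
apply/malgP => x; rewrite mcoeffD !mcoeff_part /=.
by case: (P x); rewrite ?addr0 ?add0r.
Qed.

Lemma partD P f g : part P (f + g) = part P f + part P g.
Proof.
apply/malgP => x; rewrite mcoeffD !mcoeff_part mcoeffD.
by case: (P x); rewrite ?addr0.
Qed.

Lemma part_monoM P c u g :
  part P (mono c u * g) = mono c u * part (fun x => P (x + u)) g.
Proof.
apply/malgP => x; rewrite mcoeff_part !mcoeff_monoM mcoeff_part subrK.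
by case: (P x); rewrite ?mulr0.
Qed.

End Support.

(** * Leading exponents and the absence of zero divisors *)

Lemma total_max (T : eqType) (le : T -> T -> Prop) (x : T) (s : seq T) :
  (forall a, le a a) -> (forall a b c, le a b -> le b c -> le a c) ->
  (forall a b, le a b \/ le b a) ->
  exists2 m, m \in x :: s & forall y, y \in x :: s -> le y m.
Proof.
move=> lexx le_trans le_total; elim: s x => [|a s IH] x.
  by exists x => [|y]; rewrite inE => // /eqP ->.
have [m ms mP] := IH a; have [xm|mx] := le_total x m.
  by exists m => [|y]; rewrite in_cons ?ms ?orbT // => /orP[/eqP ->|/mP].
exists x => [|y]; first by rewrite mem_head.
by rewrite in_cons => /orP[/eqP ->//|/mP ym]; exact: le_trans ym mx.
Qed.

Section Domain.
Variables (K : fieldType) (L : zmodType).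
Local Notation KL := (group_ring K L).

(** Stated for total preorders, since it serves both the lexicographic order and the preorder
    [C (x - y)], in which distinct exponents may be equivalent. *)
Lemma group_ring_max (le : L -> L -> Prop) (f : KL) :
  (forall a, le a a) -> (forall a b c, le a b -> le b c -> le a c) ->
  (forall a b, le a b \/ le b a) -> f != 0 ->
  exists2 m, f@_m != 0 & forall x, f@_x != 0 -> le x m.
Proof.
move=> le1 le2 le3 f0.
have : exists s : seq L, s = msupp f by exists (msupp f).
case=> -[|x s] Es.
  case/eqP: f0; apply/malgP => x; rewrite mcoeff0; apply: mcoeff_outdom.
  by rewrite -[_ \in _]/(x \in (msupp f : seq L)) -Es.
have [m ms mP] := total_max x s le1 le2 le3.
exists m => [|y]; first
  by rewrite mcoeff_neq0 -[_ \in _]/(m \in (msupp f : seq L)) -Es.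
by rewrite mcoeff_neq0 -[_ \in _]/(y \in (msupp f : seq L)) -Es => /mP.
Qed.

Hypothesis latL : is_lattice L.

Lemma lattice_coords : exists n (b : 'I_n -> L) (c : 'I_n -> {additive L -> int}),
  (forall u, u = \sum_i b i *~ c i u).
Proof.
case: latL => n [b bP]; have [c cP] := choice bP.
have cA i : zmod_morphism (fun u => c u i).
  move=> u v; have [_ uniq] := cP (u - v).
  suff -> : c (u - v) = [ffun j => c u j - c v j] by rewrite ffunE.
  apply: uniq; rewrite {1}(cP u).1 {1}(cP v).1 -sumrB.
  by apply: eq_bigr => j _; rewrite ffunE mulrzBr.
pose C i : {additive L -> int} :=
  HB.pack (fun u => c u i) (GRing.isZmodMorphism.Build L int _ (cA i)).
by exists n, b, C => u; exact: (cP u).1.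
Qed.

(* The strict positive cone of the lexicographic order on coordinates. *)
Lemma lattice_order : exists pos : L -> Prop,
  [/\ ~ pos 0, forall u v, pos u -> pos v -> pos (u + v) &
      forall u, [\/ u = 0, pos u | pos (- u)]].
Proof.
have [n [b [c cP]]] := lattice_coords.
exists (fun u => exists i, 0 < c i u /\ forall j : 'I_n, (j < i)%N -> c j u = 0).
split=> [[i []]|u v [i [ui ui0]] [j [vj vj0]]|u]; first by rewrite raddf0.
  case: (ltngtP i j) => ij.
  - exists i; split=> [|k ki]; rewrite raddfD /=; first by rewrite vj0 ?addr0.
    by rewrite ui0 ?vj0 ?addr0 //; exact: ltn_trans ij.
  - exists j; split=> [|k ki]; rewrite raddfD /=; first by rewrite ui0 ?add0r.
    by rewrite ui0 ?vj0 ?addr0 //; exact: ltn_trans ij.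
  - have {}ij := val_inj ij; subst j; exists i; split=> [|k ki]; rewrite raddfD /=.
      exact: addr_gt0.
    by rewrite ui0 ?vj0 ?addr0.
case: (pickP (fun i : 'I_n => c i u != 0)) => [i0 i0P|u0]; last first.
  constructor 1; rewrite (cP u) big1 // => i _.
  by move/negbFE: (u0 i) => /eqP ->.
have [i ciu imin] := @arg_minnP _ i0 (fun i => c i u != 0) (fun i => i : nat) i0P.
have z (j : 'I_n) : (j < i)%N -> c j u = 0.
  by move=> ji; apply/eqP; apply: contraLR ji => /imin; rewrite -leqNgt.
case: (ltrgtP (c i u) 0) => ciu0; last by rewrite ciu0 eqxx in ciu.
  constructor 3; exists i; rewrite raddfN oppr_gt0; split=> // j /z.
  by rewrite raddfN => ->; rewrite oppr0.
by constructor 2; exists i.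
Qed.

(** For the order of [lattice_order], the product of the leading terms is the only contribution at
    the sum of the leading exponents, so it cannot cancel. *)
Lemma group_ring_mulf_neq0 (f g : KL) : f != 0 -> g != 0 -> f * g != 0.
Proof.
move=> f0 g0; have [pos [pos0 posD posP]] := lattice_order.
pose le (x y : L) := x = y \/ pos (y - x).
have le1 a : le a a by left.
have le2 a b d : le a b -> le b d -> le a d.
  move=> [->//|ab] [<-|bd]; [by right|right].
  by rewrite -(subrKA b) ; exact: posD.
have le3 a b : le a b \/ le b a.
  case: (posP (a - b)) => [/subr0_eq -> |ab|]; [by left; left|by right; right|].
  by rewrite opprB => ab; left; right.
have [x fx xP] := group_ring_max le1 le2 le3 f0.
have [y gy yP] := group_ring_max le1 le2 le3 g0.
pose lt (m z : L) := pos (m - z).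
have split_lead (h : KL) m : (forall z, h@_z != 0 -> le z m) ->
    exists2 h', supp_in (lt m) h' & h = mono h@_m m + h'.
  move=> hm; exists (h - mono h@_m m); last by rewrite addrC subrK.
  move=> z; rewrite mcoeffB mcoeff_mono; case: (m =P z) => [<-|mz].
    by rewrite subrr eqxx.
  by rewrite subr0 => /hm[Ez|//]; rewrite Ez in mz.
have [f' f'P Ef] := split_lead _ _ xP; have [g' g'P Eg] := split_lead _ _ yP.
suff: (f * g)@_(x + y) != 0 by apply: contraNneq => ->; rewrite mcoeff0.
have fg'0 : (f * g')@_(x + y) = 0.
  apply/eqP/negPn/negP => /(supp_inM (X := le^~ x) xP g'P)[a [d [ax dy E]]].
  apply: pos0; have -> : 0 = (x - a) + (y - d) by rewrite addrACA -opprD E subrr.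
  by case: ax => [->|ax]; [rewrite subrr add0r|exact: posD].
have f'g0 : (f' * mono g@_y y)@_(x + y) = 0.
  rewrite mulrC mcoeff_monoM addrK; apply/eqP; rewrite mulf_eq0 (negPf gy) /=.
  by apply/negPn/negP => /f'P; rewrite /lt subrr.
rewrite {1}Eg mulrDr mcoeffD fg'0 addr0 {1}Ef mulrDl mcoeffD f'g0 addr0.
by rewrite mono_mul mcoeff_monoUU mulf_neq0.
Qed.

Lemma group_ring_exp_neq0 (f : KL) n : f != 0 -> f ^+ n != 0.
Proof.
move=> f0; elim: n => [|n IH]; first by rewrite expr0 oner_eq0.
by rewrite exprS group_ring_mulf_neq0.
Qed.

End Domain.

(** * Chevalley's extension argument on monomials *)

Section Directed.
Variables (K : fieldType) (L : zmodType).

(** A support is finite, so directedness handles all its exponents at once. This carries conditions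
    through unions of chains and extracts uniform degree bounds. *)
Lemma supp_in_directed (J : Type) (P : J -> L -> Prop) (f : group_ring K L) :
  inhabited J ->
  (forall i j, exists k, forall x, P i x \/ P j x -> P k x) ->
  supp_in (fun x => exists i, P i x) f -> exists i, supp_in (P i) f.
Proof.
move=> [j0] dir Pf.
suff [i Pi] : exists i, forall x, x \in (msupp f : seq L) -> P i x.
  by exists i => x; rewrite mcoeff_neq0 => /Pi.
have : forall x, x \in (msupp f : seq L) -> exists i, P i x.
  by move=> x xf; apply: Pf; rewrite mcoeff_neq0.
elim: (msupp f : seq L) => [|y s IH] Ps; first by exists j0.
have [i Pi] := IH (fun x xs => Ps x (mem_behead (s := y :: s) xs)).
have [j Pj] := Ps y (mem_head _ _).
have [k Pk] := dir i j; exists k => x; rewrite inE => /predU1P[->|/Pi Px].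
  by apply: Pk; right.
by apply: Pk; left.
Qed.

End Directed.

Local Open Scope classical_set_scope.

Lemma Zorn_above (T : Type) (Q : set (set T)) (A0 : set T) : Q A0 ->
  (forall F : set (set T), F !=set0 -> F `<=` Q -> total_on F subset ->
    Q (\bigcup_(X in F) X)) ->
  exists A, [/\ A0 `<=` A, Q A & forall B, A `<=` B -> Q B -> B `<=` A].
Proof.
move=> QA0 Qcup; pose P (X : set T) := X = set0 \/ A0 `<=` X /\ Q X.
have [F FP Ftot|A [PA Amax]] := @Zorn_bigcup T P.
  pose F' := [set X | F X /\ A0 `<=` X /\ Q X].
  have cupE : \bigcup_(X in F) X = \bigcup_(X in F') X.
    apply/seteqP; split=> x [X FX Xx]; exists X => //; last by case: FX.
    by split=> //; case: (FP _ FX) => // X0; rewrite X0 in Xx.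
  have [[X F'X]|F'0] := pselect (F' !=set0); last first.
    left; rewrite cupE; apply/seteqP; split=> // x [X F'X _].
    by case: F'0; exists X.
  right; rewrite cupE; split.
    by move=> x A0x; exists X => //; case: F'X => _ [+ _]; apply.
  apply: Qcup; [by exists X | by move=> Y [_ []] |].
  by move=> Y Z [FY _] [FZ _]; exact: Ftot.
have {}Amax B : A `<=` B -> P B -> B `<=` A.
  move=> AB PB; apply: contrapT => BA.
  by apply: (Amax B) => //; split.
have [A0A QA] : A0 `<=` A /\ Q A.
  case: PA => // EA.
  have A0A : A0 `<=` A.
    by apply: (Amax A0); [rewrite EA; exact: sub0set|right; split].
  split=> //; suff -> : A = A0 by [].
  by apply/seteqP; split=> //; rewrite EA.
exists A; split=> // B AB QB; apply: Amax => //; right; split=> //.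
exact: subset_trans A0A AB.
Qed.

Lemma bigcup_directed (T : Type) (F : set (set T)) : total_on F subset ->
  forall X Y : {X | F X}, exists Z : {X | F X},
    sval X `<=` sval Z /\ sval Y `<=` sval Z.
Proof.
move=> Ftot X Y; case: (Ftot _ _ (svalP X) (svalP Y)) => XY; [exists Y|exists X];
  by split=> //; exact: subset_refl.
Qed.

Section Valuation.
Variables (K : fieldType) (L : zmodType) (latL : is_lattice L).
Variables (I : ideal (group_ring K L)) (v : L).
Local Notation KL := (group_ring K L).
Implicit Types (f g h a : KL) (u x y : L) (N C : set L).

Definition plus_multiples N u : set L :=
  [set x | exists y (k : int), N y /\ x = y + u *~ k].

(* The last two clauses say that no nonzero Laurent polynomial in [x^v] with
   coefficients in [K[N]] vanishes modulo [I], phrased in [K[N + Zv]]. *)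
Record transcendental_over N : Prop := TranscendentalOver {
  trans0 : N 0;
  transB : forall x y, N x -> N y -> N (x - y);
  trans_supp : forall f, I f -> supp_in (plus_multiples N v) f -> f = 0;
  trans_free : forall k : int, N (v *~ k) -> k = 0 }.

(** Zorn's lemma applies because an element of [I] involves finitely many exponents, so one member
    of the chain already accounts for all of them. *)
Lemma exists_maximal_transcendental : transcendental_over [set 0] ->
  exists2 N, transcendental_over N &
    forall N', N `<=` N' -> transcendental_over N' -> N' `<=` N.
Proof.
move=> t0; have [F [X0 FX0] FQ Ftot|N [_ tN Nmax]] := Zorn_above t0; last by exists N.
have dir := bigcup_directed Ftot.
split.
- by exists X0 => //; exact: trans0 (FQ _ FX0).
- move=> x y [X FX Xx] [Y FY Yy].
  have [[Z FZ] /= [XZ YZ]] := dir (exist _ X FX) (exist _ Y FY).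
  by exists Z => //; apply: transB (FQ _ FZ) _ _ (XZ _ Xx) (YZ _ Yy).
- move=> f If fsupp.
  have [|i j|x|[X FX] Xf] :=
      supp_in_directed (J := {X | F X}) (P := fun X => plus_multiples (sval X) v) (f := f).
  + by exists; exists X0.
  + have [k [ik jk]] := dir i j; exists k => x.
    by move=> [] [y [z [Xy ->]]]; exists y, z; split=> //; [exact: ik|exact: jk].
  + by move=> /fsupp[y [k [[X FX Xy] ->]]]; exists (exist _ X FX), y, k.
  + exact: (trans_supp (FQ _ FX) If Xf).
- by move=> k [X FX Xk]; exact: trans_free (FQ _ FX) _ Xk.
Qed.

Variable N : set L.
Hypothesis tN : transcendental_over N.
Local Notation t := (mono 1 (- v) : KL).

Lemma transN x : N x -> N (- x).
Proof. by move=> Nx; rewrite -sub0r; apply: transB (trans0 tN) Nx. Qed.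

Lemma transD x y : N x -> N y -> N (x + y).
Proof. by move=> Nx Ny; rewrite -(opprK y); apply: transB Nx (transN Ny). Qed.

(* [C] plays the role of the elements of nonpositive weight. *)
Record centered C : Prop := Centered {
  cent0 : C 0;
  centD : forall x y, C x -> C y -> C (x + y);
  centN : N `<=` C;
  centv : C (- v);
  cent_supp : forall a g, supp_in N a -> supp_in C g -> I (a - t * g) -> a = 0 }.

(** Every exponent of [t * g] is in [N] minus a positive multiple of [v], hence outside [N], whereas
    transcendence forces [a = t * g]. *)
Lemma centered_base : centered [set x | exists y k, N y /\ x = y - v *+ k].
Proof.
split.
- by exists 0, 0%N; rewrite mulr0n subrr; split=> //; exact: trans0 tN.
- move=> _ _ [x [k [Nx ->]]] [y [l [Ny ->]]]; exists (x + y), (k + l)%N.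
  by rewrite mulrnDr opprD addrACA; split=> //; exact: transD.
- by move=> x Nx; exists x, 0%N; rewrite mulr0n subr0.
- by exists 0, 1%N; rewrite mulr1n sub0r; split=> //; exact: trans0 tN.
move=> a g Na Cg Iag.
have tgN : supp_in [set x | exists y k, N y /\ x = y - v *+ k.+1] (t * g).
  move=> x /(supp_in_monoM Cg)/= [y [k [Ny /(canRL (addrK _)) ->]]].
  by exists y, k; split=> //; rewrite opprK -addrA mulrS opprD (addrC (- v)).
have /eqP : a - t * g = 0.
  apply: (trans_supp tN Iag); apply: supp_inB.
    by apply: supp_in_le Na => x Nx; exists x, 0; rewrite mulr0z addr0.
  apply: supp_in_le tgN => _ [y [k [Ny ->]]]; exists y, (- k.+1%:Z).
  by rewrite mulrNz.
rewrite subr_eq0 => /eqP Ea; apply/malgP => x; rewrite mcoeff0; apply/eqP.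
apply/negPn/negP => ax.
have Nx := Na x ax; move: ax; rewrite Ea => /tgN[y [k [Ny Ex]]].
have : (k.+1%:Z : int) = 0.
  apply: (trans_free tN); rewrite -(_ : y - x = v *~ k.+1); first exact: transB tN _ _ Ny Nx.
  by rewrite Ex opprB addrC subrK.
by [].
Qed.

Lemma exists_maximal_centered :
  exists2 C, centered C & forall C', C `<=` C' -> centered C' -> C' `<=` C.
Proof.
have [F [X0 FX0] FQ Ftot|C [_ cC Cmax]] := Zorn_above centered_base; last by exists C.
have dir := bigcup_directed Ftot.
split.
- by exists X0 => //; exact: cent0 (FQ _ FX0).
- move=> x y [X FX Xx] [Y FY Yy].
  have [[Z FZ] /= [XZ YZ]] := dir (exist _ X FX) (exist _ Y FY).
  by exists Z => //; apply: centD (FQ _ FZ) _ _ (XZ _ Xx) (YZ _ Yy).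
- by move=> x Nx; exists X0 => //; exact: centN (FQ _ FX0) _ Nx.
- by exists X0 => //; exact: centv (FQ _ FX0).
- move=> a g Na gsupp Iag.
  have [|i j|x|[X FX] Xg] := supp_in_directed (J := {X | F X}) (P := sval) (f := g).
  + by exists; exists X0.
  + have [k [ik jk]] := dir i j; exists k => x.
    by move=> []; [exact: ik|exact: jk].
  + by move=> /gsupp[X FX Xx]; exists (exist _ X FX).
  + exact: (cent_supp (FQ _ FX) Na Xg Iag).
Qed.

Variable C : set L.
Hypothesis cC : centered C.

Definition upto (n : nat) u : set L :=
  [set x | exists c k, [/\ C c, (k <= n)%N & x = c + u *+ k]].

(* Chevalley's argument for extending places, on monomials: lower the larger of the
   two degrees [n], [m] by eliminating the top term of one relation with the other. *)
Lemma centered_dichotomy s u n m a1 a2 g h : (n + m <= s)%N ->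
  supp_in N a1 -> supp_in N a2 -> a1 != 0 -> a2 != 0 ->
  supp_in (upto n u) g -> supp_in (upto m (- u)) h ->
  I (a1 - t * g) -> I (a2 - t * h) -> False.
Proof.
elim: s u n m a1 a2 g h => [|s IH] u n m a1 a2 g h.
  rewrite leqn0 addn_eq0 => /andP[/eqP -> _] Na1 _ /eqP a10 _ gS _ Ig _.
  apply: a10; apply: (cent_supp cC Na1 _ Ig).
  by apply: supp_in_le gS => x [c [k [Cc]]]; rewrite leqn0 => /eqP -> ->;
    rewrite mulr0n addr0.
(* Exchanging [u] with [- u] swaps the two relations, so [n] may be taken as the larger degree. *)
wlog mn : u n m a1 a2 g h / (m <= n)%N.
  move=> W nms Na1 Na2 a10 a20 gS hS Ig Ih.
  case/orP: (leq_total m n) => mn; first exact: (W u n m a1 a2 g h).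
  by apply: (W (- u) m n a2 a1 h g) => //; rewrite ?opprK // addnC.
move=> nms Na1 Na2 a10 a20 gS hS Ig Ih.
case: m => [|m] in mn nms hS *.
  move/eqP: a20; apply; apply: (cent_supp cC Na2 _ Ih).
  by apply: supp_in_le hS => x [c [k [Cc]]]; rewrite leqn0 => /eqP -> ->;
    rewrite mulr0n addr0.
case: n => // n in mn nms gS *.
(* [g1] holds the terms of [g] that need degree [n.+1] in [u], and [h1] the terms of [h] outside
   [C]. *)
pose g' := part (fun x => `[< upto n u x >]) g.
pose g1 := part (predC (fun x => `[< upto n u x >])) g.
pose h0 := part (fun x => `[< C x >]) h.
pose h1 := part (predC (fun x => `[< C x >])) h.
have g'S : supp_in (upto n u) g' by apply: supp_in_part => x /asboolP.
have g1S : supp_in [set x | exists2 c, C c & x = c + u *+ n.+1] g1.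
  apply: supp_in_part => x /= /asboolPn nx /gS[c [k [Cc kn Ex]]].
  exists c => //; rewrite Ex; move: kn; rewrite leq_eqVlt => /predU1P[->//|kn].
  by case: nx; exists c, k.
have h0S : supp_in C h0 by apply: supp_in_part => x /asboolP.
have h1S : supp_in [set x | exists c k, [/\ C c, (k <= m)%N & x = c - u *+ k.+1]] h1.
  apply: supp_in_part => x /= /asboolPn nx /hS[c [[|k] [Cc kn Ex]]].
    by case: nx; rewrite Ex mulr0n addr0.
  by exists c, k; rewrite Ex mulNrn.
have cD := centD cC.
(* Modulo [I], [a2 - t * h0] equals [t * h1]. Multiplying the first relation by it turns the top
   part [t * g1] into [t * g1 * (t * h1)], where [u *+ n.+1] cancels against some [u *+ k.+1] with
   [k <= m]; the degree in [u] drops to [n]. *)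
pose g2 := h0 * a1 + (a2 - t * h0) * g' + t * (g1 * h1).
apply: (IH u n m.+1 (a2 * a1) a2 g2 h) => //.
- apply: supp_in_le (supp_inM Na2 Na1) => _ [x [y [Nx Ny ->]]]; exact: transD.
- exact: group_ring_mulf_neq0.
- have CS f : supp_in C f -> supp_in (upto n u) f.
    by apply: supp_in_le => x Cx; exists x, 0%N; rewrite mulr0n addr0.
  have CM f f' : supp_in C f -> supp_in (upto n u) f' -> supp_in (upto n u) (f * f').
    move=> Cf Cf'; apply: supp_in_le (supp_inM Cf Cf') =>
      _ [x [y [Cx [c [k [Cc kn ->]]] ->]]].
    by exists (x + c), k; rewrite addrA; split=> //; exact: cD.
  have NC f : supp_in N f -> supp_in C f by apply: supp_in_le; exact: centN cC.
  have tS : supp_in C t by apply: supp_in_mono => _; exact: centv cC.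
  apply: supp_inD; [apply: supp_inD|]; apply: CM => //.
  + by apply: CS; exact: NC.
  + apply: supp_inB; first exact: NC.
    by apply: supp_in_le (supp_inM tS h0S) => _ [x [y [Cx Cy ->]]]; exact: cD.
  + apply: supp_in_le (supp_inM g1S h1S) => _ [x [y [[c Cc ->] [d [k [Cd km ->]]] ->]]].
    exists (c + d), (n - k)%N; split; [exact: cD|exact: leq_subr|].
    rewrite addrACA -mulrnBr ?subSS //.
    exact: (@leq_trans m.+1).
- have -> : a2 * a1 - t * g2 =
      t * g1 * (a2 - t * h) + (a2 - t * h0) * (a1 - t * g).
    by rewrite /g2 [in RHS](partC (fun x => `[< upto n u x >]) g)
               [in RHS](partC (fun x => `[< C x >]) h) -/g' -/g1 -/h0 -/h1; ring.
  by apply: idealD; exact: idealM.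
Qed.

Hypothesis Cmax : forall C', C `<=` C' -> centered C' -> C' `<=` C.

(** If [u] is outside the maximal [C], adjoining its multiples destroys [cent_supp], which yields a
    relation with exponents in some [upto n u]. Relations for both [u] and [- u] contradict
    [centered_dichotomy]. *)
Lemma centered_total u : C u \/ C (- u).
Proof.
have step w : ~ C w -> exists n a g,
    [/\ supp_in N a, a != 0, supp_in (upto n w) g & I (a - t * g)].
  move=> nCw; apply: contrapT => nex; apply: nCw.
  pose C' := [set x | exists n, upto n w x].
  have CC' : C `<=` C' by move=> x Cx; exists 0%N, x, 0%N; rewrite mulr0n addr0.
  apply: (Cmax CC'); last first.
    by exists 1%N, 0, 1%N; rewrite add0r; split=> //; exact: cent0 cC.
  split=> [|x y|x /(centN cC)||a g Na gS Iag].
  - exact: (CC' _ (cent0 cC)).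
  - move=> [n [c [k [Cc kn ->]]]] [m [d [l [Cd lm ->]]]].
    exists (n + m)%N, (c + d), (k + l)%N; rewrite mulrnDr addrACA.
    by split=> //; [exact: (centD cC)|exact: leq_add].
  - exact: CC'.
  - exact: (CC' _ (centv cC)).
  - apply: contrapT => /eqP a0.
    have [|n m|n gn] := supp_in_directed _ _ gS; first by exists; exact: 0%N.
    + exists (maxn n m) => x.
      by move=> [] [c [k [Cc kn ->]]]; exists c, k; rewrite leq_max kn ?orbT.
    + by apply: nex; exists n, a, g.
have [Cu|/step[n [a1 [g [Na1 a10 gS Ig]]]]] := pselect (C u); first by left.
have [Cu|/step[m [a2 [h [Na2 a20 hS Ih]]]]] := pselect (C (- u)); first by right.
by case: (centered_dichotomy (leqnn _) Na1 Na2 a10 a20 gS hS Ig Ih).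
Qed.

End Valuation.

(** * A rational weight from algebraic relations *)

Section RankOne.
Variables (K : fieldType) (L : zmodType) (latL : is_lattice L).
Variables (I : ideal (group_ring K L)) (v : L) (N C : set L).
Local Notation KL := (group_ring K L).
Implicit Types (f g h a : KL) (u x y z : L).
Hypothesis tN : transcendental_over I v N.
Hypothesis Nmax : forall N', N `<=` N' -> transcendental_over I v N' -> N' `<=` N.
Hypothesis cC : centered I v N C.
Hypothesis Ctot : forall u, C u \/ C (- u).

Let cD x y : C x -> C y -> C (x + y). Proof. exact: (centD cC). Qed.

Let cMn x m : C x -> C (x *+ m).
Proof.
move=> Cx; elim: m => [|m IH]; first by rewrite mulr0n; exact: cent0 cC.
by rewrite mulrS; exact: cD.
Qed.

(** Otherwise [- x] lies in [C] by totality, and adding [m] copies of it to [x *+ m.+1] returns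
    [x]. *)
Let c_div x m : C (x *+ m.+1) -> C x.
Proof.
move=> Cmx; case: (Ctot x) => // /(cMn m) Cx.
by rewrite -(addrK (x *+ m) x) -mulrS -mulNrn; exact: cD.
Qed.

(** Otherwise [1 = t * mono 1 v] violates [cent_supp] with [a = 1]. *)
Lemma centered_nv : ~ C v.
Proof.
move=> Cv; have /eqP := oner_neq0 KL; apply.
apply: (cent_supp cC (a := 1) (g := mono 1 v)).
- by apply: supp_in_mono => _; exact: trans0 tN.
- exact: supp_in_mono.
by rewrite -{1}(monoV K v) mulrC subrr; exact: ideal0.
Qed.

(* Multiples of [x] eventually pass [- v]; the other nonpositive [x] are
   infinitesimal with respect to [v]. *)
Definition far_below x : Prop := exists m, C (x *+ m + v).

Definition negligible x : Prop := ~ far_below x /\ ~ far_below (- x).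

Lemma far_below_cent x : far_below x -> C x.
Proof.
move=> [m Cxm]; case: (Ctot x) => // /(cMn m) Cx; case: centered_nv.
by rewrite -(addrK (x *+ m) v) addrC (addrC v) -mulNrn; exact: cD.
Qed.

Lemma cent_far_below x : C x -> ~ far_below (- x).
Proof.
move=> Cx [m Cmx]; apply: centered_nv.
by have := cD Cmx (cMn m Cx); rewrite mulNrn addrAC addNr add0r.
Qed.

Lemma far_belowD x y : far_below x -> far_below y -> far_below (x + y).
Proof.
move=> [m Cx] /far_below_cent Cy; exists m.
by rewrite mulrnDl addrAC; apply: cD => //; exact: cMn.
Qed.

Lemma far_below_mulrn x m : far_below (x *+ m.+1) <-> far_below x.
Proof.
split=> [[k Ck]|bx]; first by exists (m.+1 * k)%N; rewrite mulrnA.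
elim: m => [|m IH]; first by rewrite mulr1n.
by rewrite mulrS; exact: far_belowD.
Qed.

Lemma far_belowNv : far_below (- v).
Proof. by exists 1%N; rewrite mulr1n addNr; exact: cent0 cC. Qed.

Lemma far_belowDr x z : far_below x -> negligible z -> far_below (x + z).
Proof.
(* Doubling the multiplier leaves a spare copy of [v], which absorbs the contribution of [z]: as
   [- z] is not far below, [z *+ (m * 2) - v] is in [C]. *)
move=> [m Cx] [_ nz]; exists (m * 2)%N.
have Cz : C (z *+ (m * 2) - v).
  case: (Ctot (z *+ (m * 2) - v)) => // Cz; case: nz; exists (m * 2)%N.
  by rewrite mulNrn addrC -opprB.
rewrite -[X in C X](_ : (x *+ m + v) *+ 2 + (z *+ (m * 2) - v) = _).
  by apply: cD => //; exact: cMn.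
by rewrite !mulrnDl -mulrnA addrACA (mulr2n v) addrK.
Qed.

Lemma negligible0 : negligible 0.
Proof. by split; rewrite ?oppr0 -[0]oppr0; apply: cent_far_below; exact: cent0 cC. Qed.

Lemma negligibleN x : negligible x -> negligible (- x).
Proof. by case=> nx nNx; split; rewrite ?opprK. Qed.

Lemma negligibleD x y : negligible x -> negligible y -> negligible (x + y).
Proof.
move=> Zx Zy; split=> [|/far_belowDr/(_ Zy)].
  by move=> /far_belowDr/(_ (negligibleN Zy)); rewrite addrK; case: Zx.
by rewrite opprD subrK; case: Zx.
Qed.

Lemma negligibleB x y : negligible x -> negligible y -> negligible (x - y).
Proof. by move=> Zx /negligibleN; exact: negligibleD. Qed.

Lemma negligibleMn x m : negligible x -> negligible (x *+ m).
Proof.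
move=> Zx; elim: m => [|m IH]; first by rewrite mulr0n; exact: negligible0.
by rewrite mulrS; exact: negligibleD.
Qed.

Lemma negligible_trans x : N x -> negligible x.
Proof.
move=> Nx; split; last exact: cent_far_below (centN cC Nx).
by rewrite -[x]opprK; apply: cent_far_below; exact: centN cC _ (transN tN Nx).
Qed.

Lemma far_below_mulrz (k : int) : k < 0 -> far_below (v *~ k).
Proof.
case: k => // k _; rewrite NegzE mulrNz -mulNrz.
exact/far_below_mulrn/far_belowNv.
Qed.

Lemma negligible_mulrz (k : int) : negligible (v *~ k) -> k = 0.
Proof.
move=> [nk nNk]; case: (ltrgtP k 0) => // k0.
  by case: nk; exact: far_below_mulrz.
by case: nNk; rewrite -mulrNz; apply: far_below_mulrz; rewrite oppr_lt0.
Qed.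

Lemma supp_in_exp_far_below m g k :
  supp_in (fun x => C (x *+ m + v)) g ->
  supp_in (fun x => C (x *+ m + v *+ k)) (g ^+ k).
Proof.
move=> gS; elim: k => [|k IH].
  by rewrite expr0; apply: supp_in_mono => _; rewrite mul0rn mulr0n addr0; exact: cent0 cC.
rewrite exprS; apply: supp_in_le (supp_inM gS IH) => _ [x [y [Cx Cy ->]]].
by rewrite mulrnDl mulrS addrACA; exact: cD.
Qed.

(** Strengthens [cent_supp]: only multiples of the exponents of [g] have to pass [- v]. A power of
    the congruence reduces to [cent_supp], and the group ring has no nonzero nilpotents. *)
Lemma far_below_supp a g : supp_in N a -> supp_in far_below g -> I (a - g) -> a = 0.
Proof.
(* The multiplier is shifted by one to make it positive, as the division by [c_div] requires. *)
move=> Na gS Iag; pose P m x := C (x *+ m.+1 + v).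
have [|i j|x /gS[m Cm]|m gm] := supp_in_directed (P := P) (f := g).
- by exists; exact: 0%N.
- have Pm k l x : P k x -> P (k + l)%N x.
    move=> Ckx; rewrite /P -addSn mulrnDr addrAC; apply: cD => //; apply: cMn.
    by apply: far_below_cent; exists k.+1.
  by exists (i + j)%N => x [] /Pm; last rewrite addnC; exact.
- exists m; rewrite /P mulrS -addrA; apply: cD => //.
  by apply: far_below_cent; exists m.
have NaX k : supp_in N (a ^+ k).
  elim: k => [|k IH]; first by rewrite expr0; apply: supp_in_mono => _; exact: trans0 tN.
  rewrite exprS; apply: supp_in_le (supp_inM Na IH) => _ [x [y [Nx Ny ->]]].
  exact: transD tN _ _ Nx Ny.
(* Exponents of [g ^+ m.+1] are below [- v], whence the centering of [C] applies. *)
have : a ^+ m.+1 = 0.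
  apply: (cent_supp cC (NaX _) (g := mono 1 v * g ^+ m.+1)).
    move=> x /(supp_in_monoM (supp_in_exp_far_below gm)).
    by rewrite -mulrnDl subrK; exact: c_div.
  rewrite mulrA (mulrC (mono _ _)) monoV mul1r subrXX mulrC.
  exact: idealM.
by apply: contra_eq; exact: group_ring_exp_neq0.
Qed.

(** Otherwise [u] and [v] are independent modulo negligible elements, and then adjoining [u] to [N]
    preserves transcendence, contradicting the maximality of [N]. *)
Lemma commensurable u :
  exists m (k : int), negligible (u *+ m.+1 - v *~ k).
Proof.
apply: contrapT => nex.
have indep (j k : int) : negligible (u *~ j - v *~ k) -> j = 0.
  case: j => [[|j]|j] // Zjk; case: nex; exists j; first by exists k.
  exists (- k); rewrite mulrNz opprK.
  by move/negligibleN: Zjk; rewrite NegzE mulrNz opprB opprK addrC.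
have [Nu|nNu] := pselect (N u).
  apply: nex; exists 0%N, 0; rewrite mulr0z subr0 mulr1n.
  exact: negligible_trans.
pose N' := plus_multiples N u.
have NN' : N `<=` N' by move=> x Nx; exists x, 0; rewrite mulr0z addr0.
apply: nNu; apply: (Nmax NN'); last first.
  by exists 0, 1; rewrite add0r; split=> //; exact: trans0 tN.
split.
- exact: NN' _ (trans0 tN).
- move=> _ _ [x [j [Nx ->]]] [y [k [Ny ->]]].
  exists (x - y), (j - k); rewrite mulrzBr opprD addrACA.
  by split=> //; exact: (transB tN).
- move=> f If fS; apply: contrapT => /eqP f0.
  pose le x y := C (x - y).
  have [x|x y z xy yz|x y|x0 fx0 x0max] := group_ring_max (le := le) _ _ _ f0.
  + by rewrite /le subrr; exact: cent0 cC.
  + by rewrite /le -(subrKA y); exact: cD.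
  + by rewrite /le -(opprB x y); exact: Ctot.
  (* The leading exponent of [f'] is 0, and by [indep] only exponents in [N] are as
     large as 0, so the leading part of [f'] lies in [K[N]]. *)
  pose P x := `[< N x >]; pose f' := mono 1 (- x0) * f.
  have f'E x : f'@_x = f@_(x + x0) by rewrite mcoeff_monoM mul1r opprK.
  have : part P f' = 0.
    apply: (far_below_supp (g := - part (predC P) f')).
    - by apply: supp_in_part => x /asboolP.
    - apply: supp_inN; apply: supp_in_part => x /= /asboolPn nNx.
      rewrite f'E => fx; have Cx : C x by have := x0max _ fx; rewrite /le addrK.
      apply: contrapT => nbx; apply: nNx.
      have Zx : negligible x by split=> //; exact: cent_far_below.
      have [_ [k [[y [j [Ny ->]] Ex]]]] := fS _ fx.
      have [_ [k0 [[y0 [j0 [Ny0 ->]] Ex0]]]] := fS _ fx0.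
      have Ny' : N (y - y0) by exact: (transB tN).
      have Ex' : x = (y - y0) + (u *~ (j - j0) + v *~ (k - k0)).
        by rewrite -[LHS](addrK x0) Ex Ex0 !mulrzBr !opprD !addrA !(addrAC _ _ (- y0))
                   !(addrAC _ _ (- (u *~ j0))).
      have Zy := negligible_trans Ny'.
      have Zuv : negligible (u *~ (j - j0) + v *~ (k - k0)).
        by have := negligibleB Zx Zy; rewrite {1}Ex' addrC addKr.
      have j0E : j - j0 = 0.
        by apply: (indep _ (k0 - k)); rewrite -mulrNz opprB.
      have k0E : k - k0 = 0.
        by apply: negligible_mulrz; move: Zuv; rewrite j0E mulr0z add0r.
      by rewrite Ex' j0E k0E !mulr0z !addr0.
    - by rewrite opprK -partC; exact: idealM.
  move/malgP => /(_ 0); rewrite mcoeff_part mcoeff0 f'E add0r /P asboolT.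
    by apply/eqP.
  exact: trans0 tN.
- move=> k [y [j [Ny E]]]; apply: (trans_free tN).
  have j0 : j = 0.
    apply: (indep _ k); rewrite E opprD addrCA subrr addr0.
    exact/negligibleN/negligible_trans.
  by rewrite E j0 mulr0z addr0.
Qed.

Let cross_sub u m n (k l : int) :
  (u *+ m - v *~ k) *+ n - (u *+ n - v *~ l) *+ m = v *~ (l * m%:Z - k * n%:Z).
Proof.
rewrite !mulrnBl -!mulrnA (mulnC n) opprB addrC subrKA mulrzBr !mulrzA.
by rewrite !pmulrn.
Qed.

(** The weight of [u] is [k / m.+1] whenever [u *+ m.+1 - v *~ k] is negligible. It is well defined
    because no nonzero multiple of [v] is negligible, and additive by passing to a common
    denominator. *)
Lemma rank_one_weight : exists w : {additive L -> rat},
  w v = 1 /\ forall x, w x < 0 -> far_below x.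
Proof.
have [p pP] := choice (fun u => let: ex_intro m (ex_intro k Z) := commensurable u in
  ex_intro (fun p : nat * int => negligible (u *+ p.1.+1 - v *~ p.2)) (m, k) Z).
pose w u : rat := (p u).2%:~R / (p u).1.+1%:R.
have wE u m k : negligible (u *+ m.+1 - v *~ k) -> w u = k%:~R / m.+1%:R.
  move=> /(negligibleMn (p u).1.+1) Zk.
  have := negligibleB (negligibleMn m.+1 (pP u)) Zk.
  rewrite cross_sub => /negligible_mulrz/subr0_eq E.
  apply/eqP; rewrite eqr_div ?pnatr_eq0 //.
  by rewrite !pmulrn -!intrM E.
have w_additive : zmod_morphism w.
  move=> x y; set m := (p x).1; set n := (p y).1.
  have E : ((m * n.+1 + n).+1 = m.+1 * n.+1)%N by rewrite -addnS mulSnr.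
  (* [m * n.+1 + n] is the predecessor of the common denominator [m.+1 * n.+1]. *)
  rewrite (wE (x - y) (m * n.+1 + n)%N ((p x).2 * n.+1%:Z - (p y).2 * m.+1%:Z)).
    rewrite /w -/m -/n E natrM intrB !intrM.
    by field; rewrite !nat1r !pnatr_eq0.
  have := negligibleB (negligibleMn n.+1 (pP x)) (negligibleMn m.+1 (pP y)).
  rewrite -/m -/n E !mulrnBl -!mulrnA (mulnC n.+1) mulrzBr !mulrzA -!pmulrn.
  by rewrite !opprD [in X in X -> _]addrACA.
pose W := GRing.isZmodMorphism.Build L rat w w_additive.
pose wA : {additive L -> rat} := HB.pack w W.
exists wA; split=> /=.
  by rewrite (wE v 0%N 1) ?divr1 // mulr1n subrr; exact: negligible0.
(* A negative weight gives a negative multiple of [v], which is far below; a positive multiple of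
   [x] differs from it by a negligible element. *)
move=> x; rewrite /w pmulr_llt0 ?invr_gt0 ?ltr0n // ltrz0 => /far_below_mulrz.
by move=> /far_belowDr/(_ (pP x)); rewrite addrC subrK => /far_below_mulrn.
Qed.

End RankOne.

(** * Initial ideals and algebraicity of monomials *)

Section InitialIdeal.
Variables (K : fieldType) (L : zmodType) (I : ideal (group_ring K L)).
Variable w : {additive L -> rat}.
Local Notation KL := (group_ring K L).
Implicit Types (f g h r : KL) (c : rat).

(* For [h] homogeneous of weight [c]: [h] is zero or the initial form of an element
   of [I]. *)
Definition liftable c h : Prop :=
  exists2 r, supp_in (fun x => w x < c) r & I (h + r).

Let isw c := fun x => w x == c.

(** Imposed on every homogeneous component, so that the property is stable under multiplication by
    arbitrary elements and defines an ideal. *)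
Definition homogeneously_liftable g : Prop :=
  forall c, liftable c (part (isw c) g).

Lemma liftable0 c : liftable c 0.
Proof. by exists 0; rewrite ?addr0; [exact: supp_in0 | exact: ideal0]. Qed.

Lemma liftableD c h1 h2 : liftable c h1 -> liftable c h2 -> liftable c (h1 + h2).
Proof.
move=> [r1 r1S I1] [r2 r2S I2]; exists (r1 + r2); first exact: supp_inD.
by rewrite addrACA; exact: idealD.
Qed.

Lemma liftable_monoM c a u h :
  liftable (c - w u) h -> liftable c (mono a u * h).
Proof.
move=> [r rS Ihr]; exists (mono a u * r); last by rewrite -mulrDr; exact: idealM.
by apply: supp_in_le (supp_in_monoM rS) => x; rewrite raddfB ltrD2r.
Qed.

Lemma homogeneously_liftable0 : homogeneously_liftable 0.
Proof.
move=> c; suff -> : part (isw c) 0 = 0 :> KL by exact: liftable0.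
by apply/malgP => x; rewrite mcoeff_part mcoeff0 if_same.
Qed.

Lemma homogeneously_liftableD g1 g2 : homogeneously_liftable g1 ->
  homogeneously_liftable g2 -> homogeneously_liftable (g1 + g2).
Proof. by move=> H1 H2 c; rewrite partD; exact: liftableD. Qed.

Lemma homogeneously_liftableM a g :
  homogeneously_liftable g -> homogeneously_liftable (a * g).
Proof.
move=> Hg; rewrite [a]group_ringE mulr_suml.
apply: (big_ind homogeneously_liftable) => [|f1 f2|u _].
- exact: homogeneously_liftable0.
- exact: homogeneously_liftableD.
move=> c; rewrite part_monoM; apply: liftable_monoM.
rewrite (_ : part _ g = part (isw (c - w u)) g); first exact: Hg.
apply: eq_bigl => x; rewrite /isw raddfD.
by rewrite eq_sym -subr_eq eq_sym.
Qed.

(** The initial form has terms in the top weight only. There [f] itself is the lift, its other terms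
    having lower weight; in any other weight the component is zero. *)
Lemma initial_form_liftable f : I f -> homogeneously_liftable (initial_form w f).
Proof.
move=> If c; pose top x := all (fun u => w u <= w x) (msupp f).
have inE : initial_form w f = part top f by [].
have topP x u : top x -> f@_u != 0 -> w u <= w x.
  by rewrite mcoeff_neq0 => /allP; apply.
have [[x fx tx]|nx] := pselect (exists2 x, f@_x != 0 & top x /\ w x = c); last first.
  suff -> : part (isw c) (initial_form w f) = 0 by exact: liftable0.
  apply/malgP => x; rewrite inE !mcoeff_part mcoeff0.
  case: ifP => // /eqP wx; case: ifP => // tx.
  by apply/eqP/negPn/negP => fx; apply: nx; exists x.
case: tx => tx wx; exists (part (predC top) f).
  apply: supp_in_part => y /= nty fy.
  rewrite lt_neqAle -wx (topP _ _ tx fy) andbT; apply: contra nty => /eqP wyx.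
  by apply/allP => u; rewrite -mcoeff_neq0 wyx => /(topP _ _ tx).
suff -> : part (isw c) (initial_form w f) = part top f by rewrite -partC.
apply/malgP => y; rewrite inE !mcoeff_part; case: ifP => // wy.
case: ifP => // ty; apply/esym/eqP/negPn/negP => fy; case/negP: (negbT wy).
by rewrite /isw -wx eq_le (topP _ _ tx fy) (topP _ _ ty fx).
Qed.

(** The homogeneously liftable elements form an ideal containing the initial ideal. If the latter
    were the unit ideal, the weight 0 component of 1 would lift to some [1 + r] in [I]. *)
Lemma weight_tropical :
  (forall r, supp_in (fun x => w x < 0) r -> ~ I (1 + r)) -> tropical_variety I w.
Proof.
move=> I1 all_in.
pose J := Ideal homogeneously_liftable0 homogeneously_liftableD homogeneously_liftableM.
have /(_ 0) : J 1.
  by apply: (all_in 1) => _ [f If ->]; exact: initial_form_liftable.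
suff -> : part (isw 0) (1 : KL) = mono 1 0 by case=> r rS; exact: I1.
apply/malgP => x; rewrite mcoeff_part -(mono10 K L) mcoeff_mono.
by case: (0 =P x) => [<-|_]; rewrite ?mulr0n ?if_same // /isw raddf0 eqxx.
Qed.

End InitialIdeal.

Section Algebraic.
Variables (K : fieldType) (L : zmodType) (latL : is_lattice L).
Variables (I : ideal (group_ring K L)).
Local Notation KL := (group_ring K L).

Lemma lattice_torsion_free (v : L) (k : int) : v != 0 -> v *~ k = 0 -> k = 0.
Proof.
move=> v0 vk; have [n [b [c cP]]] := lattice_coords latL.
apply/eqP/negPn/negP => k0; case/eqP: v0; rewrite (cP v) big1 // => i _.
have /eqP : c i (v *~ k) = 0 by rewrite vk raddf0.
by rewrite raddfMz mulrz_eq0 (negPf k0) => /eqP ->.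
Qed.

Lemma perp_algebraic (v : L) : v != 0 -> v \in tropical_perp I ->
  exists2 f, f != 0 & I f /\ supp_in (fun x => exists k : int, x = v *~ k) f.
Proof.
move=> v0 /asboolP vperp; apply: contrapT => nalg.
have t0 : transcendental_over I v [set 0].
  split=> [//|_ _ -> ->|f If fS|k /= vk]; last exact: lattice_torsion_free v0 vk.
    by rewrite subrr.
  apply: contrapT => /eqP f0; apply: nalg; exists f => //; split=> //.
  by apply: supp_in_le fS => _ [_ [k [-> ->]]]; exists k; rewrite add0r.
have [N tN Nmax] := exists_maximal_transcendental t0.
have [C cC Cmax] := exists_maximal_centered tN.
have Ctot := centered_total latL tN cC Cmax.
have [w [wv wlt0]] := rank_one_weight latL tN Nmax cC Ctot.
suff /vperp/eqP : tropical_variety I w by rewrite wv oner_eq0.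
(* If [1 + r] is in [I] with [r] of negative weight, the exponents of [r] are far below, and
   [far_below_supp] with [a = 1] gives [1 = 0]. *)
apply: weight_tropical => r rS I1r.
have /eqP := oner_neq0 KL; apply.
apply: (far_below_supp latL tN cC Ctot (g := - r)); last by rewrite opprK.
  by apply: supp_in_mono => _; exact: trans0 tN.
by apply: supp_inN; apply: supp_in_le rS.
Qed.

(** Among nonzero relations with exponents [0, v, ..., v *+ n], minimality of [n] makes the top
    coefficient nonzero; dividing by it gives a monic relation. *)
Lemma perp_integral (v : L) : v \in tropical_perp I ->
  exists (n : nat) (r : KL), supp_in (fun x => exists2 k, (k < n)%N & x = v *+ k) r /\
    I (mono 1 (v *+ n) - r).
Proof.
have [->|v0] := eqVneq v 0.
  exists 1%N, (mono 1 0); rewrite mul0rn subrr; split; last exact: ideal0.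
  by apply: supp_in_mono => _; exists 0%N; rewrite ?mulr0n.
move=> /(perp_algebraic v0)[f f0 [If fS]].
pose P n := `[< exists g : KL, [/\ g != 0, I g &
  supp_in (fun x => exists2 k, (k <= n)%N & x = v *+ k) g] >].
have [|n /asboolP[g [g0 Ig gS]] nmin] := @ex_minnP P.
  have [|i j|x|m fm] := supp_in_directed
    (P := fun m x => exists2 k : int, (`|k| <= m)%N & x = v *~ k) (f := f).
  - by exists; exact: 0%N.
  - by exists (maxn i j) => x; case=> -[k km ->]; exists k; rewrite ?leq_max ?km ?orbT.
  - by move=> /fS[k ->]; exists `|k|%N, k.
  (* Multiplying by the monomial of [v *+ m] moves the multiples between [- m] and [m] to those
     between [0] and [m + m]. *)
  exists (m + m)%N; apply/asboolP; exists (mono 1 (v *+ m) * f); split.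
  - by rewrite group_ring_mulf_neq0 ?mono_eq0 ?oner_eq0.
  - exact: idealM.
  apply: supp_in_le (supp_in_monoM fm) => x [k km] /(canRL (subrK _)) ->.
  exists (absz (k + m%:Z)); first by lia.
  by rewrite (pmulrn _ m) -mulrzDr (pmulrn _ `|_|) gez0_abs //; lia.
have [k kn gk] : exists2 k, k = n & g@_(v *+ k) != 0.
  exists n => //; apply/negP => /eqP gn0.
  case: n => [|n] in nmin gS gn0.
    case/eqP: g0; apply/malgP => x; rewrite mcoeff0; apply/eqP/negPn/negP => gx.
    have [k + Ex] := gS x gx; rewrite leqn0 => /eqP k0.
    by rewrite Ex k0 gn0 eqxx in gx.
  suff /nmin : P n by rewrite ltnn.
  apply/asboolP; exists g; split=> // x gx.
  have [k kn Ex] := gS x gx; exists k => //; move: kn; rewrite leq_eqVlt.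
  by case/predU1P=> // kn; rewrite Ex kn gn0 eqxx in gx.
subst k; set c := g@_(v *+ n) in gk.
exists n, (mono 1 (v *+ n) - mono c^-1 0 * g); split; last first.
  by rewrite opprB addrC subrK; exact: idealM.
move=> x; rewrite mcoeffB mcoeff_mono mcoeff_monoM subr0.
have [<-|nx] := eqVneq (v *+ n) x; first by rewrite mulr1n -/c mulVf ?subrr ?eqxx.
rewrite mulr0n sub0r oppr_eq0 mulf_eq0 negb_or => /andP[_ /gS[k kn Ex]].
by exists k => //; rewrite ltn_neqAle kn andbT; apply: contraNneq nx => <-; apply/eqP.
Qed.

End Algebraic.

(** * Finite generation of subgroups of a lattice *)

Section SubgroupGenerators.
Variables (L : zmodType) (latL : is_lattice L).
Variable H : set L.
Hypotheses (H0 : H 0) (HB : forall x y, H x -> H y -> H (x - y)).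

(** Multiplicities are natural numbers because monic relations serve to lower large nonnegative
    exponents. *)
Definition monoid_span (s : seq L) x : Prop :=
  exists k : nat -> nat, x = \sum_(i < size s) s`_i *+ k i.

(** Induction on the number [m] of initial coordinates that may be nonzero. Euclidean division by
    the least positive value of the last of them makes that coordinate vanish. *)
Lemma subgroup_generated : exists s : seq L,
  (forall y, y \in s -> H y) /\ forall x, H x -> monoid_span s x.
Proof.
have [n [b [c cP]]] := lattice_coords latL.
have HN x : H x -> H (- x) by move=> Hx; rewrite -sub0r; exact: HB.
have HD x y : H x -> H y -> H (x + y) by move=> Hx /HN Hy; rewrite -(opprK y); exact: HB.
have HMz x (k : int) : H x -> H (x *~ k).
  move=> Hx; have Hn m : H (x *+ m).
    by elim: m => [|m IH]; rewrite ?mulr0n // mulrS; exact: HD.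
  by case: k => m; [exact: Hn|rewrite NegzE mulrNz; apply: HN; exact: Hn].
suff span_below : forall m, (m <= n)%N -> exists s : seq L,
    (forall y, y \in s -> H y) /\
    forall x, H x -> (forall i : 'I_n, (m <= i)%N -> c i x = 0) -> monoid_span s x.
  have [s [sH sP]] := span_below n (leqnn n).
  by exists s; split=> // x Hx; apply: sP => // i; rewrite leqNgt ltn_ord.
elim=> [|m IH] mn.
  exists [::]; split=> // x _ x0; exists (fun=> 0%N).
  rewrite big_ord0 (cP x) big1 // => i _.
  by rewrite x0 ?mulr0z.
have [s [sH sP]] := IH (ltnW mn); pose j := Ordinal mn.
pose V x := H x /\ forall i : 'I_n, (m < i)%N -> c i x = 0.
have VE x : V x -> c j x = 0 -> forall i : 'I_n, (m <= i)%N -> c i x = 0.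
  move=> [_ Vx] cjx i; rewrite leq_eqVlt => /predU1P[mi|/Vx//].
  by rewrite -[i](_ : j = i) //; apply: val_inj.
pose P d := `[< (0 < d)%N /\ exists2 y, V y & c j y = d%:Z >].
have [exP|nexP] := pselect (exists d, P d); last first.
  exists s; split=> // x Hx x0; apply: sP => //; apply: (VE x) => //.
  apply/eqP/negPn/negP => cx; apply: nexP; exists `|c j x|%N; apply/asboolP.
  rewrite absz_gt0 cx; split=> //.
  have [cx0|cx0] := leP 0 (c j x); first by exists x => //; rewrite gez0_abs.
  exists (- x); last by rewrite raddfN lez0_abs // ltW.
  by split=> [|i mi]; [exact: HN|rewrite raddfN x0 ?oppr0].
have [d /asboolP[d0 [y [Hy Vy] cy]] dmin] := ex_minnP exP.
(* Both signs are listed because [monoid_span] has no negative multiplicities. *)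
exists [:: y, - y & s]; split=> [z|x Hx x0].
  by rewrite !inE => /or3P[/eqP ->|/eqP ->|/sH] //; exact: HN.
pose q := (c j x %/ d)%Z.
have Vr : V (x - y *~ q).
  split=> [|i mi]; first by apply: HB => //; exact: HMz.
  by rewrite raddfB raddfMz x0 // Vy // mul0rz subrr.
have cr : c j (x - y *~ q) = (c j x %% d)%Z.
  by rewrite raddfB raddfMz cy mulrzz mulrC /modz.
have r0 : c j (x - y *~ q) = 0.
  apply/eqP/negPn/negP => r0.
  have d_neq0 : d%:Z != 0 by lia.
  have r_ge0 : 0 <= c j (x - y *~ q) by rewrite cr modz_ge0.
  have : P (absz (c j (x - y *~ q))).
    apply/asboolP; rewrite absz_gt0 r0; split=> //.
    by exists (x - y *~ q); rewrite ?gez0_abs.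
  move=> /dmin; rewrite leqNgt => /negP; apply.
  by rewrite -ltz_nat gez0_abs // cr ltz_pmod.
have [k kE] := sP _ Vr.1 (VE _ Vr r0).
(* The multiplicities of [y] and [- y] are the positive and negative parts of [q]. *)
pose a : nat := if q is Posz a then a else 0%N.
pose a' : nat := if q is Negz a then a.+1 else 0%N.
exists (fun i => match i with 0 => a | 1 => a' | i.+2 => k i end).
rewrite !big_ord_recl /= -kE addrA -[LHS](subrK (y *~ q)) addrC; congr (_ + _).
rewrite /a /a'; case: (q) => b'; first by rewrite mulr0n addr0.
by rewrite mulr0n add0r NegzE mulrNz mulNrn.
Qed.

End SubgroupGenerators.

(** * Finite dimension and descending chains *)

Section BoxSpan.
Variables (K : fieldType) (L : zmodType) (latL : is_lattice L).
Variables (I : ideal (group_ring K L)) (s : seq L).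
Local Notation KL := (group_ring K L).
Hypothesis sI : forall y, y \in s -> y \in tropical_perp I.

Definition box_point D (e : {ffun 'I_(size s) -> 'I_D}) : L :=
  \sum_(i < size s) s`_i *+ e i.

Definition box_spanned D (f : KL) : Prop :=
  exists c : {ffun 'I_(size s) -> 'I_D} -> K,
    I (f - \sum_e mono (c e) (box_point e)).

Lemma box_spanned0 D : box_spanned D 0.
Proof.
exists (fun=> 0); rewrite big1 ?subr0; first exact: ideal0.
by move=> e _; apply/eqP; rewrite mono_eq0.
Qed.

Lemma box_spannedD D f g :
  box_spanned D f -> box_spanned D g -> box_spanned D (f + g).
Proof.
move=> [c cf] [d dg]; exists (fun e => c e + d e).
rewrite (_ : _ - _ = f - \sum_e mono (c e) (box_point e) +
                     (g - \sum_e mono (d e) (box_point e))); first exact: idealD.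
rewrite addrACA -opprD -big_split /=; congr (_ - _); apply: eq_bigr => e _.
exact: monalgUD.
Qed.

Lemma box_spannedZ D a f : box_spanned D f -> box_spanned D (mono a 0 * f).
Proof.
move=> [c cf]; exists (fun e => a * c e).
rewrite (_ : _ - _ = mono a 0 * (f - \sum_e mono (c e) (box_point e))).
  exact: idealM.
rewrite mulrBr mulr_sumr; congr (_ - _); apply: eq_bigr => e _.
by rewrite mono_mul add0r.
Qed.

Lemma box_spanned_mod D f g : I (f - g) -> box_spanned D g -> box_spanned D f.
Proof.
move=> Ifg [c cg]; exists c.
by rewrite -(subrKA g); exact: idealD.
Qed.

Lemma box_spanned_point D (e : {ffun 'I_(size s) -> 'I_D}) :
  box_spanned D (mono 1 (box_point e)).
Proof.
exists (fun e' => (e' == e)%:R); rewrite (bigD1 e) //= eqxx big1 ?addr0.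
  by rewrite subrr; exact: ideal0.
by move=> e' /negPf ->; apply/eqP; rewrite mono_eq0.
Qed.

(** [D] bounds the degrees of monic relations for the generators. Once a multiplicity reaches [D],
    such a relation rewrites the monomial by monomials of smaller total multiplicity; induction on
    the total ends inside the box. *)
Lemma exists_spanning_box : exists D, forall x, monoid_span s x ->
  box_spanned D (mono 1 x).
Proof.
have integral (i : 'I_(size s)) : exists n, exists r : KL,
    supp_in (fun x => exists2 k, (k < n)%N & x = s`_i *+ k) r /\
    I (mono 1 (s`_i *+ n) - r).
  by apply: perp_integral => //; apply: sI; exact: mem_nth.
have [d dP] := choice integral; pose D := (\max_i d i)%N; exists D => x [k ->].
have [n kn] := ubnP (\sum_(i < size s) k i)%N.
elim: n k kn => // n IH k kn.
have [/existsP[i0 Di0]|/existsPn small] := boolP [exists i : 'I_(size s), D <= k i]%N;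
  last first.
  have {}small (i : 'I_(size s)) : (k i < D)%N by rewrite ltnNge; exact: small.
  rewrite (_ : \sum_i _ = box_point [ffun i => Ordinal (small i)]).
    exact: box_spanned_point.
  by apply: eq_bigr => i _; rewrite ffunE.
have [r [rS Ir]] := dP i0.
have dk : (d i0 <= k i0)%N by apply: leq_trans Di0; exact: leq_bigmax.
pose upd m (i : nat) := if i == i0 then m else k i.
pose rest := \sum_(i < size s | i != i0) s`_i *+ k i.
have updE m : \sum_(i < size s) s`_i *+ upd m i = s`_i0 *+ m + rest.
  rewrite (bigD1 i0) //= /upd eqxx; congr (_ + _).
  by apply: eq_bigr => i /negPf ii0; rewrite -[_ == _]/(i == i0) ii0.
have upd_sum m : (\sum_(i < size s) upd m i = m + \sum_(i < size s | i != i0) k i)%N.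
  rewrite (bigD1 i0) //= /upd eqxx; congr (_ + _)%N.
  by apply: eq_bigr => i /negPf ii0; rewrite -[_ == _]/(i == i0) ii0.
have kE : \sum_(i < size s) s`_i *+ k i = s`_i0 *+ k i0 + rest by rewrite (bigD1 i0).
(* [y] is what remains after removing [d i0] copies of the generator; the terms of [r] put back only
   [j < d i0] copies. *)
pose y := s`_i0 *+ (k i0 - d i0) + rest.
apply: (@box_spanned_mod _ _ (mono 1 y * r)).
  rewrite (_ : mono 1 _ = mono 1 y * mono 1 (s`_i0 *+ d i0)).
    by rewrite -mulrBr; exact: idealM.
  by rewrite mono_mul mulr1 kE /y addrAC -mulrnDr subnK.
rewrite [r]group_ringE mulr_sumr big_seq.
apply: (big_ind (@box_spanned D)) => [|f g|z]; first exact: box_spanned0.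
  exact: box_spannedD.
rewrite -mcoeff_neq0 => /rS[j jd Ez].
rewrite (_ : _ * _ = mono r@_z 0 * mono 1 (y + z)); last first.
  by rewrite !mono_mul mul1r mulr1 add0r.
apply: box_spannedZ.
rewrite (_ : y + z = \sum_(i < size s) s`_i *+ upd (k i0 - d i0 + j)%N i).
  apply: IH; move: kn; rewrite upd_sum (bigD1 i0) //=.
  by move: jd dk; set q := (\sum_(i < _ | _) _)%N; lia.
by rewrite updE Ez /y addrAC -mulrnDr.
Qed.

End BoxSpan.

Section Artinian.
Variable K : fieldType.

(** A matrix of maximal rank among those with row space inside [W] spans [W], since a vector of [W]
    outside its row space could be added to raise the rank. *)
Lemma subspace_mx N (W : 'rV[K]_N -> Prop) :
  W 0 -> (forall u v, W u -> W v -> W (u + v)) -> (forall a u, W u -> W (a *: u)) ->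
  exists M : 'M[K]_N, forall u, W u <-> (u <= M)%MS.
Proof.
move=> W0 WD WZ.
pose P d := `[< exists2 M : 'M[K]_N, forall u : 'rV_N, (u <= M)%MS -> W u & \rank M = d >].
have exP : exists d, P d.
  exists 0%N; apply/asboolP; exists 0; rewrite ?mxrank0 // => u.
  by rewrite submx0 => /eqP ->.
have ubP d : P d -> (d <= N)%N by move=> /asboolP[M _ <-]; exact: rank_leq_row.
have [d /asboolP[M MW rM] dmax] := ex_maxnP exP ubP.
exists M => u; split=> [Wu|]; last exact: MW.
have sMu : (M <= M + u)%MS by exact: addsmxSl.
apply: submx_trans (addsmxSr M u) _; rewrite -(mxrank_leqif_sup sMu).
rewrite eqn_leq mxrankS //= rM dmax //; apply/asboolP; exists (M + u)%MS => // v.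
case/sub_addsmxP => -[a b] /= ->; apply: WD; first by apply: MW; exact: submxMl.
by rewrite [b]mx11_scalar mul_scalar_mx; exact: WZ.
Qed.

(** Pulled back along the surjection from row vectors, the ideals of the chain become nested
    subspaces, and from a member of minimal rank on these coincide. *)
Lemma finite_dimensional_artinian (A : comPzRingType) (iota : {rmorphism K -> A})
    (J : ideal A) (T : finType) (E : T -> A) :
  (forall a, exists c : T -> K, J (a - \sum_e iota (c e) * E e)) ->
  artinian_ideal J.
Proof.
move=> spanE F Fdesc; pose N := #|T|.
pose phi (u : 'rV[K]_N) : A := \sum_e iota (u 0 (enum_rank e)) * E e.
pose pi (a : A) : quot_ring J := \pi_(quot_ring J)%qT a.
have pi0 : pi 0 = 0 by rewrite -{1}(subrr 0) [LHS]quot_pi_is_zmod_morphism subrr.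
have piD a b : pi (a + b) = pi a + pi b by exact: quot_piD.
have piM a b : pi (a * b) = pi a * pi b by exact: quot_piM.
have phi_surj x : exists u, x = pi (phi u).
  have [c cP] := spanE (repr x); exists (\row_i c (enum_val i)).
  rewrite -[LHS]reprK; apply/eqP; rewrite quot_ringP; apply/asboolP.
  rewrite (_ : phi _ = \sum_e iota (c e) * E e) //; apply: eq_bigr => e _.
  by rewrite mxE enum_rankK.
have exM n : exists M : 'M[K]_N, forall u, F n (pi (phi u)) <-> (u <= M)%MS.
  apply: (subspace_mx (W := fun u => F n (pi (phi u)))) => [|u v Fu Fv|a u Fu].
  - rewrite (_ : phi 0 = 0) ?pi0; first exact: ideal0.
    by rewrite /phi big1 // => e _; rewrite mxE rmorph0 mul0r.
  - rewrite (_ : phi (u + v) = phi u + phi v) ?piD; first exact: idealD.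
    by rewrite /phi -big_split; apply: eq_bigr => e _; rewrite mxE rmorphD mulrDl.
  - rewrite (_ : phi (a *: u) = iota a * phi u) ?piM; first exact: idealM.
    by rewrite /phi mulr_sumr; apply: eq_bigr => e _; rewrite mxE rmorphM mulrA.
have [M MP] := choice exM.
pose P d := `[< exists n, \rank (M n) = d >].
have exP : exists d, P d by exists (\rank (M 0%N)); apply/asboolP; exists 0%N.
have [d /asboolP[n rMn] dmin] := ex_minnP exP.
have Fle m m' x : (m <= m')%N -> F m' x -> F m x.
  move=> /subnK <-; elim: (m' - m)%N => // k IH; rewrite addSn => /Fdesc; exact: IH.
exists n => m nm x; split; first exact: Fle.
have sM : (M m <= M n)%MS.
  by apply/row_subP => i; apply/MP/(Fle _ _ _ nm)/MP; exact: row_sub.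
have sM' : (M n <= M m)%MS.
  rewrite -(mxrank_leqif_sup sM) eqn_leq mxrankS //= rMn dmin //.
  by apply/asboolP; exists m.
by have [u ->] := phi_surj x => /MP uM; apply/MP; exact: submx_trans uM sM'.
Qed.

End Artinian.

(** * Scalars and monomials of the subring, and the conclusion *)

Section SubGroupRingScalars.
Variables (K : fieldType) (L : zmodType) (S : zmodClosed L).

Lemma mono_supported_in (c : K) (u : L) : u \in S -> mono c u \in supported_in S.
Proof.
move=> uS; apply/allP => x; rewrite -mcoeff_neq0 mcoeff_mono.
by case: (u =P x) => [<-|]; rewrite ?eqxx.
Qed.

Definition sgr_mono (u : L) (uS : u \in S) : sub_group_ring K S :=
  SubGroupRing (mono_supported_in 1 uS).

Definition sgr_scalar (c : K) : sub_group_ring K S :=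
  SubGroupRing (mono_supported_in c (rpred0 S)).

Lemma sgr_scalar_zmod_morphism : zmod_morphism sgr_scalar.
Proof. by move=> c d; apply: val_inj; exact: monalgUB. Qed.

Lemma sgr_scalar_monoid_morphism : monoid_morphism sgr_scalar.
Proof.
by split=> [|c d]; apply: val_inj => //=; rewrite [RHS]mono_mul addr0.
Qed.

HB.instance Definition _ := GRing.isZmodMorphism.Build K (sub_group_ring K S)
  sgr_scalar sgr_scalar_zmod_morphism.
HB.instance Definition _ := GRing.isMonoidMorphism.Build K (sub_group_ring K S)
  sgr_scalar sgr_scalar_monoid_morphism.

End SubGroupRingScalars.

Theorem theorem13 (K : fieldType) (L : zmodType) (latL : is_lattice L)
    (I : ideal (group_ring K L)) :
  artinian_ideal (restrict_ideal (tropical_perp I) I).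
Proof.
pose S : zmodClosed L := tropical_perp I.
have [||s [sS sP]] := subgroup_generated latL (H := fun x => x \in S).
- exact: rpred0.
- exact: rpredB.
have [D Dspan] := exists_spanning_box latL sS.
have boxS (e : {ffun 'I_(size s) -> 'I_D}) : box_point e \in S.
  by apply: rpred_sum => i _; apply: rpredMn; apply: sS; exact: mem_nth.
apply: (finite_dimensional_artinian (iota := @sgr_scalar K L S)
          (E := fun e => sgr_mono K (boxS e))) => a.
(* The exponents of [a] lie in [S], hence in the monoid span of [s]. The reduction takes place in
   the whole group ring modulo [I] and descends to the subring, whose ideal is the contraction of
   [I]. *)
have [c cP] : box_spanned I s D (val a).
  rewrite [val a]group_ringE big_seq.
  apply: (big_ind (@box_spanned _ _ I s D)) => [|f g|x xa]; first exact: box_spanned0.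
    exact: box_spannedD.
  rewrite (_ : mono _ x = mono (val a)@_x 0 * mono 1 x); last first.
    by rewrite mono_mul mulr1 add0r.
  by apply/box_spannedZ/Dspan/sP; exact: (allP (valP a)).
exists c; rewrite /=.
rewrite -[X in I X]/(val (a - _)) raddfB raddf_sum.
rewrite (eq_bigr (fun e => mono (c e) (box_point e))) // => e _.
by rewrite [LHS]mono_mul mulr1 add0r.
Qed.
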